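(* Let $P$ be a finite poset with underlying set $V$, $|V|=n$. Then the map $r$ is a bijection from the set of weakly decreasing Hamiltonian paths on $P$ to the set of acyclic orientations of $\mathrm{inc}(P)$, and its inverse is the map $s$.
   Context: $\mathrm{inc}(P)$ is the graph on $V$ with an edge between $v$ and $w$ iff $v,w$ are incomparable in $P$. A weakly decreasing Hamiltonian path on $P$ is a sequence $(v_1,\ldots,v_n)$ listing each element of $V$ exactly once such that for each $i$, $v_i$ is not less than $v_{i+1}$ in $P$. For such a path $F$, $r(F)$ is the orientation of $\mathrm{inc}(P)$ obtained as follows: for $i=1,2,\ldots,n$ in turn, direct every not yet directed edge of $\mathrm{inc}(P)$ incident to $v_i$ toward $v_i$ (equivalently, an edge between $v_i$ and $v_j$ with $i<j$ is directed from $v_j$ to $v_i$). For an acyclic orientation $A$ of $\mathrm{inc}(P)$, $s(A)$ is the sequence $(v_1,\ldots,v_n)$ where $v_i$ is the greatest element in $P$ of the set of sinks of the restriction of $A$ to $V\setminus\{v_1,\ldots,v_{i-1}\}$ (this set of sinks is nonempty and, being pairwise non-adjacent in $\mathrm{inc}(P)$, is totally ordered by $P$). *)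

(* Defs.v *)
From mathcomp Require Import all_boot all_order.

Set Implicit Arguments.
Unset Strict Implicit.
Unset Printing Implicit Defensive.

Local Open Scope order_scope.

Section Digraphs.
Variable T : finType.
Implicit Types (e : rel T) (A : {set T * T}) (U : {set T}).

(* A set of arcs: (v, w) \in A means that A has an arc directed from v to w.  *)
Definition arc A : rel T := fun v w => (v, w) \in A.

(* e is the (symmetric, irreflexive) adjacency relation of a simple graph.    *)
Definition orientation e A : Prop :=
  (forall v w, arc A v w -> e v w) /\
  (forall v w, e v w -> arc A v w (+) arc A w v).

Definition acyclic A : Prop := forall c : seq T, ucycle (arc A) c -> c = [::].

Definition acyclic_orientation e A : Prop := orientation e A /\ acyclic A.

Definition restrict A U : {set T * T} := A :&: setX U U.

Definition sinks A U : {set T} :=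
  [set v in U | [forall w, ~~ arc (restrict A U) v w]].

End Digraphs.

Section Paths.
Variables (d : Order.disp_t) (P : finPOrderType d).
Implicit Types (F : seq P) (A D : {set P * P}).

Definition inc : rel P := fun v w => v >< w.

Definition weakly_decreasing_hampath F : Prop :=
  (forall v, count_mem v F = 1%N) /\ sorted (fun v w => ~~ (v < w)) F.

(* D is the set of edges directed so far.                                     *)
Definition direct_toward D (v : P) : {set P * P} :=
  D :|: [set a | [&& a.2 == v, inc a.1 v, ~~ arc D a.1 v & ~~ arc D v a.1]].

Definition r F : {set P * P} := foldl direct_toward set0 F.

Definition greatest (S : {set P}) : option P :=
  [pick v in S | [forall w in S, w <= v]].

(* The None case, a set of sinks without greatest element, does not occur for *)
(* acyclic orientations of inc; it would leave s A with fewer than #|P| terms.*)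
Definition s_step A F : seq P :=
  if greatest (sinks A [set v | v \notin F]) is Some v then rcons F v else F.

Definition s A : seq P := iter #|P| (s_step A) [::].

End Paths.

(* Main.v *)
From mathcomp Require Import classical_sets functions.
From mathcomp Require Import all_boot all_order.
Require Import Defs.

(** The arcs of [r F] are the incomparable pairs [(v, w)] such that [w] precedes
    [v] in [F].  Both inverse laws say that, for an acyclic orientation [A], an
    enumeration [F] of the vertices lists at each step the greatest remaining
    sink of [A] if and only if [F] is weakly decreasing and [r F = A].

    If [F] lists greatest sinks, then the arcs of [A] go backwards along [F],
    so that [A = r F].  Moreover [F] is weakly decreasing: if [x] came right
    after some [y < x], then [x], not being adjacent to [y], would already have
    been a sink when [y] was chosen, so [y] was not the greatest one.

    Conversely, let [F] be weakly decreasing and let [w], listed after [v], be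
    a sink of [r F] restricted to [v] and the later vertices.  Then [w] is
    comparable with every vertex listed from [v] on and before [w]; going back
    from [w], weak decrease forces each of them to be greater than [w].  Hence
    [v] is the greatest sink. *)

Set Implicit Arguments.
Unset Strict Implicit.
Unset Printing Implicit Defensive.

Import Order.POrderTheory.

Section Sequences.
Variable T : eqType.
Implicit Types (s : seq T) (e : rel T) (x y : T).

Lemma finite_axiomP s : Finite.axiom s <-> uniq s /\ s =i T.
Proof.
split=> [s1|[]]; last exact: Finite.uniq_enumP.
have sT : s =i T by move=> x; rewrite inE -has_pred1 has_count s1.
by split=> //; apply: count_mem_uniq => x; rewrite sT s1.
Qed.

Lemma mem_take_index s x y :
  (x \in take (index y s) s) = (index x s < index y s).
Proof. by rewrite in_take_leq ?index_size. Qed.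

Lemma index_lt_rcons s x y z :
    x \notin s ->
  (index y (rcons s x) < index z (rcons s x)) =
    (index y s < index z s) || [&& y == x, z \notin s & z != x].
Proof.
move=> xs; rewrite -cats1 !index_cat /= !(eq_sym x).
have [ys|/memNindex->] := boolP (y \in s).
  have /negPf->/= : y != x by apply: contraNneq xs => <-.
  rewrite orbF; have [//|/memNindex->] := ifPn.
  by rewrite index_mem ys ltn_addr ?index_mem.
rewrite [size s < index _ _]ltnNge index_size /=.
have [zs|_] := boolP (z \in s); last by rewrite ltn_add2l; do 2!case: eqP.
by rewrite andbF ltnNge (leq_trans (index_size _ _)) ?leq_addr.
Qed.

Lemma uniq_sortedP e s :
    uniq s ->
  sorted e s <-> {in s &, forall x y, index y s = (index x s).+1 -> e x y}.
Proof.
move=> s_uniq; split=> [s_sorted x y x_s y_s xy|e_next].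
  have := (sortedP x s_sorted) (index x s); rewrite -xy index_mem y_s.
  by rewrite !nth_index // => /(_ isT).
case: s s_uniq e_next => // x0 s s_uniq e_next.
apply/(sortedP x0) => i i_lt; have i_lt' := ltnW i_lt.
by apply: e_next; rewrite ?mem_nth ?index_uniq.
Qed.

End Sequences.

Section Digraphs.
Variable T : finType.
Implicit Types (e : rel T) (A : {set T * T}) (U : {set T}) (f : T -> nat).
Implicit Types v w : T.

Lemma sinksP A U v :
  reflect (v \in U /\ {in U, forall w, ~~ arc A v w}) (v \in sinks A U).
Proof.
rewrite inE; apply: (iffP andP) => -[vU v_sink]; split=> //.
  move=> w wU; move/forallP/(_ w): v_sink.
  by rewrite /arc !inE /= vU wU !andbT.
apply/forallP => w; rewrite /arc !inE /= vU.
by apply/negP => /andP[vw /v_sink/negP].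
Qed.

Lemma acyclic_arc_connect A v w :
  acyclic A -> arc A v w -> ~~ connect (arc A) w v.
Proof.
move=> A_acyclic vw; apply/negP => /connectP[p0 p0_path v_last].
case/shortenP: p0_path v_last => p p_path p_uniq _ v_last.
suff /A_acyclic : ucycle (arc A) (w :: p) by [].
by rewrite /ucycle /ucycleb /= rcons_path p_path -v_last vw.
Qed.

(* A vertex of [U] reaching as few vertices as possible is a sink: otherwise an
   out-neighbour in [U] would reach fewer. *)
Lemma acyclic_sinks_neq0 A U : acyclic A -> U != set0 -> sinks A U != set0.
Proof.
move=> A_acyclic /set0Pn[u uU]; apply/set0Pn.
have [v vU v_min] := @arg_minnP _ u (mem U) (fun v => #|connect (arc A) v|) uU.
exists v; apply/sinksP; split=> // w wU; apply/negP => vw.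
have := v_min w wU; rewrite leqNgt => /negP[]; apply/proper_card/properP.
split; last by exists v; rewrite ?inE ?connect0 ?acyclic_arc_connect.
by apply/subsetP => x; apply/connect_trans/connect1.
Qed.

Definition orient_by e f : {set T * T} :=
  [set a | e a.1 a.2 && (f a.2 < f a.1)].

Lemma arc_orient_by e f v w : arc (orient_by e f) v w = e v w && (f w < f v).
Proof. by rewrite /arc inE. Qed.

Lemma acyclic_orient_by e f : acyclic (orient_by e f).
Proof.
move=> [//|v c] /andP[/= vc _].
have : path (fun x y => f y < f x) v (rcons c v).
  by apply: sub_path vc => x y; rewrite arc_orient_by => /andP[].
move/order_path_min => /(_ (fun _ _ _ yx zy => ltn_trans zy yx)).
by rewrite all_rcons ltnn.
Qed.

Lemma acyclic_orientation_orient_by e f :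
    symmetric e -> (forall v w, e v w -> f v != f w) ->
  acyclic_orientation e (orient_by e f).
Proof.
move=> e_sym f_proper; split; last exact: acyclic_orient_by.
split=> v w; first by rewrite arc_orient_by => /andP[].
move=> vw; rewrite !arc_orient_by (e_sym w) vw /=.
by case: ltngtP (f_proper v w vw).
Qed.

Lemma orientation_eq_orient_by e f A :
    orientation e A -> (forall v w, arc A v w -> f w < f v) ->
  A = orient_by e f.
Proof.
move=> [A_sub A_total] f_decr; apply/setP => -[v w].
rewrite -[LHS]/(arc A v w) -[RHS]/(arc _ v w) arc_orient_by.
apply/idP/andP => [vw|[/A_total vw wv]].
  by split; [exact: A_sub|exact: f_decr].
move: vw; case: (boolP (arc A w v)) => [/f_decr|_]; last by rewrite addbF.
by rewrite ltnNge ltnW.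
Qed.

End Digraphs.

Local Notation not_lt := (fun v w => ~~ (v < w)%O).

Section WeaklyDecreasing.
Variables (d : Order.disp_t) (T : porderType d).

Lemma weakly_decreasing_le (F : seq T) v w :
    uniq F -> sorted not_lt F -> w \in F -> index v F <= index w F ->
    (forall u, index v F <= index u F < index w F -> (u >=< w)%O) ->
  (w <= v)%O.
Proof.
move=> F_uniq F_sorted wF.
have [n] := ubnP (index w F - index v F); elim: n v => // n IH v.
move=> vw_n vw vw_comp; have w_lt : index w F < size F by rewrite index_mem.
have vF : v \in F by rewrite -index_mem (leq_ltn_trans vw).
move: vw; rewrite leq_eqVlt => /predU1P[/(index_inj v vF wF)->//|vw].
have next_lt : (index v F).+1 < size F := leq_ltn_trans vw w_lt.
pose v' := nth v F (index v F).+1.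
have v'E : index v' F = (index v F).+1 by rewrite index_uniq.
have w_le_next : (w <= v')%O.
  apply: IH; rewrite v'E //.
    exact: leq_trans (ltn_sub2l vw (ltnSn _)) vw_n.
  by move=> u /andP[/ltnW vu uw]; apply: vw_comp; rewrite vu.
have v_not_lt_next : ~~ (v < v')%O.
  by have /uniq_sortedP-> := F_sorted; rewrite ?mem_nth.
have := vw_comp v; rewrite leqnn vw => /(_ isT).
case: comparableP => // /lt_le_trans/(_ w_le_next).
by rewrite (negbTE v_not_lt_next).
Qed.

End WeaklyDecreasing.

Section Paths.
Variables (d : Order.disp_t) (P : finPOrderType d).
Implicit Types (F : seq P) (A : {set P * P}) (S U : {set P}) (u v w x : P).

Local Notation inc := (@inc d P).

Lemma inc_sym : symmetric inc.
Proof. by move=> v w; rewrite /Defs.inc comparable_sym. Qed.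

Lemma inc_irr : irreflexive inc.
Proof. by move=> v; rewrite /Defs.inc comparablexx. Qed.

Lemma greatestP S v :
  greatest S = Some v <-> v \in S /\ {in S, forall w, (w <= v)%O}.
Proof.
rewrite /greatest; split=> [|[vS v_ge]].
  by case: pickP => // u /andP[uS /forall_inP u_ge] [<-].
case: pickP => [u /andP[uS /forall_inP u_ge]|/(_ v)].
  by congr Some; apply: le_anti; rewrite v_ge // u_ge.
by rewrite vS /= => /forall_inP[]; apply: v_ge.
Qed.

Lemma greatest_chain S :
    {in S &, forall v w, (v >=< w)%O} -> S != set0 ->
  exists v, greatest S = Some v.
Proof.
move=> S_chain /set0Pn[u uS].
have [v vS v_ge] := @comparable_arg_maxP _ _ _ u (mem S) id uS S_chain.
by exists v; apply/greatestP.
Qed.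

Lemma greatest_sinks A U :
    acyclic_orientation inc A -> U != set0 ->
  exists v, greatest (sinks A U) = Some v.
Proof.
move=> [[_ A_total] A_acyclic] U0.
apply: greatest_chain; last exact: acyclic_sinks_neq0.
move=> v w /sinksP[vU v_sink] /sinksP[wU w_sink].
apply: contraT => /A_total.
by rewrite (negbTE (v_sink w wU)) (negbTE (w_sink v vU)).
Qed.

Lemma r_orient_by F : uniq F -> r F = orient_by inc (index^~ F).
Proof.
elim/last_ind: F => [|F x IH].
  by move=> _; apply/setP => a; rewrite !inE ltnn andbF.
rewrite rcons_uniq => /andP[xF /IH rF]; apply/setP => -[v w].
rewrite /r -cats1 foldl_cat /= -/(r F) rF cats1 !inE !arc_orient_by.
rewrite index_lt_rcons // (memNindex xF) index_mem (inc_sym x) /=.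
rewrite [size F < _]ltnNge index_size andbF.
have [->|_] := eqVneq w x; last by rewrite !orbF.
rewrite (memNindex xF) [size F < _]ltnNge index_size andbF /=.
have [->|_] := eqVneq v x; first by rewrite inc_irr.
by rewrite andbT; case: (inc v x).
Qed.

Definition greatest_sink_order A F : Prop :=
  {in F, forall v,
    greatest (sinks A [set w | w \notin take (index v F) F]) = Some v}.

Lemma greatest_sink_order_arc A F v w :
    greatest_sink_order A F -> v \in F -> arc A v w -> index w F < index v F.
Proof.
move=> /[apply] /greatestP[/sinksP[_ v_sink] _]; apply: contraLR.
by rewrite -leqNgt => vw; apply: v_sink; rewrite inE mem_take_index -leqNgt.
Qed.

Lemma greatest_sink_order_sorted A F :
    orientation inc A -> uniq F -> greatest_sink_order A F ->
  sorted not_lt F.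
Proof.
move=> [A_sub _] F_uniq F_greatest; apply/uniq_sortedP => // v w vF wF wE.
have /greatestP[_ v_ge] := F_greatest v vF; apply/negP => vw.
have w_arcN u : index w F <= index u F -> ~~ arc A w u.
  move=> wu; apply/negP => /(greatest_sink_order_arc F_greatest wF).
  by rewrite ltnNge wu.
suff /v_ge/le_gtF : w \in sinks A [set u | u \notin take (index v F) F].
  by rewrite vw.
apply/sinksP; rewrite inE mem_take_index wE -leqNgt leqnSn; split=> // u.
rewrite inE mem_take_index -leqNgt leq_eqVlt -wE => /predU1P[uE|/w_arcN//].
have uF : u \in F by rewrite -index_mem -uE index_mem.
rewrite -(index_inj v vF uF uE); apply/negP => /A_sub.
by rewrite /Defs.inc gt_comparable.
Qed.

Lemma greatest_sink_order_r F :
  weakly_decreasing_hampath F -> greatest_sink_order (r F) F.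
Proof.
move=> [/finite_axiomP[F_uniq F_enum] F_sorted] v vF; apply/greatestP; split.
  apply/sinksP; rewrite inE mem_take_index ltnn; split=> // w.
  rewrite inE mem_take_index r_orient_by // arc_orient_by => /negPf->.
  by rewrite andbF.
move=> w /sinksP[]; rewrite inE mem_take_index -leqNgt => vw w_sink.
apply: weakly_decreasing_le vw _; rewrite ?F_enum // => u /andP[vu uw].
have := w_sink u; rewrite inE mem_take_index -leqNgt => /(_ vu).
by rewrite r_orient_by // arc_orient_by uw andbT negbK comparable_sym.
Qed.

Lemma acyclic_orientation_r F :
  Finite.axiom F -> acyclic_orientation inc (r F).
Proof.
move=> /finite_axiomP[F_uniq F_enum]; rewrite r_orient_by //.
apply: acyclic_orientation_orient_by inc_sym _ => v w.
by apply: contraTneq => /(index_inj v (F_enum v) (F_enum w))->; rewrite inc_irr.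
Qed.

Lemma s_greatest_sink_order A F :
  Finite.axiom F -> greatest_sink_order A F -> s A = F.
Proof.
move=> /finite_axiomP[F_uniq F_enum] F_greatest.
suff iter_take i : i <= size F -> iter i (s_step A) [::] = take i F.
  have size_F : size F = #|P| by rewrite -(card_uniqP F_uniq); apply: eq_card.
  by rewrite /s -size_F iter_take ?take_size.
elim: i => [|i IH] i_lt; first by rewrite take0.
have x0 : P by case: F i_lt {F_uniq F_enum F_greatest IH}.
have := F_greatest _ (mem_nth x0 i_lt); rewrite index_uniq // => next_i.
by rewrite iterS IH ?(ltnW i_lt) // /s_step next_i (take_nth x0).
Qed.

Lemma uniq_s_step A F : uniq F -> uniq (s_step A F).
Proof.
rewrite /s_step; case v_next: greatest => [v|] //= F_uniq.
have /greatestP[/sinksP[vF _] _] := v_next.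
by rewrite inE in vF; rewrite rcons_uniq vF.
Qed.

Lemma uniq_s A : uniq (s A).
Proof. by rewrite /s; elim: #|P| => //= n; apply: uniq_s_step. Qed.

Lemma greatest_sink_order_s_step A F :
  greatest_sink_order A F -> greatest_sink_order A (s_step A F).
Proof.
rewrite /s_step; case v_next: greatest => [v|] //= F_greatest w.
have /greatestP[/sinksP[vF _] _] := v_next; rewrite inE in vF.
rewrite mem_rcons inE -cats1 index_cat => /predU1P[->|wF].
  by rewrite (negPf vF) /= eqxx addn0 take_size_cat.
by rewrite wF takel_cat ?index_size // F_greatest.
Qed.

Lemma greatest_sink_order_s A : greatest_sink_order A (s A).
Proof.
by rewrite /s; elim: #|P| => //= n; apply: greatest_sink_order_s_step.
Qed.

Lemma size_s_step A F :
  acyclic_orientation inc A -> size F < #|P| -> size (s_step A F) = (size F).+1.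
Proof.
move=> A_acyc_orient F_lt; rewrite /s_step.
have F_missing : [set v | v \notin F] != set0.
  apply: contraTneq F_lt => F_full.
  rewrite -leqNgt (leq_trans _ (card_size F)) //.
  apply/subset_leq_card/subsetP => v _.
  by have := in_set0 v; rewrite -F_full inE => /negbFE.
by have [v ->] := greatest_sinks A_acyc_orient F_missing; rewrite size_rcons.
Qed.

Lemma finite_axiom_s A : acyclic_orientation inc A -> Finite.axiom (s A).
Proof.
move=> A_acyc_orient; apply/finite_axiomP; split; first exact: uniq_s.
have size_iter i : i <= #|P| -> size (iter i (s_step A) [::]) = i.
  by elim: i => //= i IH i_lt; rewrite size_s_step ?IH // ltnW.
apply/subset_cardP; rewrite ?subset_predT //.
by rewrite (card_uniqP (uniq_s A)) size_iter.
Qed.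

Lemma s_eqP A F :
    acyclic_orientation inc A ->
  s A = F <-> weakly_decreasing_hampath F /\ r F = A.
Proof.
move=> A_acyc_orient; split=> [<-|[F_path <-]]; last first.
  by apply: s_greatest_sink_order (greatest_sink_order_r F_path); case: F_path.
have [A_orient _] := A_acyc_orient.
have s_enum := finite_axiom_s A_acyc_orient; split.
  split=> //; apply: (greatest_sink_order_sorted A_orient (uniq_s A)).
  exact: greatest_sink_order_s.
rewrite r_orient_by ?uniq_s //; apply/esym/orientation_eq_orient_by => // v w.
apply/greatest_sink_order_arc; first exact: greatest_sink_order_s.
by have /finite_axiomP[_ ->] := s_enum.
Qed.

End Paths.

Local Open Scope classical_set_scope.

Theorem theorem3p8 (d : Order.disp_t) (P : finPOrderType d) :
  let paths := [set F : seq P | weakly_decreasing_hampath F] in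
  let orientations :=
    [set A : {set P * P} | acyclic_orientation (@inc d P) A] in
  set_bij paths orientations (@r d P) /\
  [/\ (forall A, orientations A -> paths (s A)),
      (forall F, paths F -> s (r F) = F) &
      (forall A, orientations A -> r (s A) = A)].
Proof.
move=> paths orientations.
have r_orientation F : paths F -> orientations (r F).
  by move=> [F_enum _]; apply: acyclic_orientation_r.
have s_pathK A : orientations A -> paths (s A) /\ r (s A) = A.
  by move=> A_acyc_orient; apply/(s_eqP _ A_acyc_orient).
have rK F : paths F -> s (r F) = F.
  by move=> F_path; apply/s_eqP; [exact: r_orientation|].
split; last by split=> // A /s_pathK[].
split=> [//|F G /set_mem/rK FK /set_mem/rK GK FG|A /s_pathK[A_path AK]].
  by rewrite -FK FG GK.
by exists (s A).
Qed.
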